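(* Let $X$ be a compact Kähler manifold, and let $\mathcal{T}^\cdot_{\mathbb{C}}$, $N$, $\Phi$ and $\theta$ be as in the context. For $\mu\in\mathbb{C}^*$ consider the holomorphic map $\phi^+_\mu:\mathbb{P}^1(\mathbb{C})\smallsetminus\{\infty\}\to\mathrm{Aut}(\mathcal{T}^\cdot_{\mathbb{C}})$ given by $$\phi^+_\mu(z)=\exp\left(\frac{\mu^z-1}{z}\,N\right),$$ and let $\phi^-(z)=\exp(-N/z)$. Then the loop $\phi_\mu(z)=\phi^-(z)^{-1}\phi^+_\mu(z)$ satisfies $$\phi_{\lambda\mu}(\epsilon)=\theta_{t\epsilon}(\phi_\mu(\epsilon)),\qquad\forall\,\lambda=e^t\in\mathbb{R}^*_+,\ \epsilon\in\partial\Delta,$$ where $\Delta\subset\mathbb{P}^1(\mathbb{C})$ is a disk around $z=0$.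
   Context: $X$ has complex dimension $n$; $\Omega^{p,q}_X$ denotes global smooth $(p,q)$-forms; $U,\hbar$ are formal variables. For $p,q\ge0$, $m=p+q$, put $\Lambda_{p,q}=\{(r,k)\in\mathbb{Z}^2: k\ge\max\{0,\,2r+m,\,\tfrac{|p-q|+2r+m}{2}\}\}$. $\mathcal{T}^\cdot$ is the real vector space spanned by the elements $\alpha\otimes U^r\otimes\hbar^k$ with $\alpha=\xi+\bar\xi$, $\xi\in\Omega^{p,q}_X$, and $(r,k)\in\Lambda_{p,q}$; $\mathcal{T}^\cdot_{\mathbb{C}}$ is its complexification. $N=U\hbar$ is the operator sending $\alpha\otimes U^r\otimes\hbar^k$ to $\alpha\otimes U^{r+1}\otimes\hbar^{k+1}$ if $(r+1,k+1)\in\Lambda_{p,q}$ and to $0$ otherwise. $\Phi=-U\frac{\partial}{\partial U}$, i.e. multiplication by $-r$ on $\alpha\otimes U^r\otimes\hbar^k$. For endomorphisms $a$ of $\mathcal{T}^\cdot_{\mathbb{C}}$, $\theta_t(a)=e^{-t\Phi}\,a\,e^{t\Phi}$, with the same formula used for complex values of $t$. Powers are $\mu^z=e^{z\log\mu}$, with logarithms chosen so that $\log(\lambda\mu)=\log\lambda+\log\mu$ for $\lambda\in\mathbb{R}^*_+$ ($\log\lambda$ real). *)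

(* Defs.v *)
(* The topology of the complex numbers [R[i]] is carried by the alias [R[i]^o]. *)
From HB Require Import structures.
From mathcomp Require Import all_boot all_order all_algebra.
From mathcomp Require Import complex.
From mathcomp Require Import all_classical all_reals all_analysis.

Set Implicit Arguments.
Unset Strict Implicit.
Unset Printing Implicit Defensive.

Import Order.TTheory GRing.Theory Num.Theory.
Import numFieldNormedType.Exports.

Local Open Scope classical_set_scope.
Local Open Scope ring_scope.
Local Open Scope complex_scope.

Notation Cn R n := ('rV[(R[i])^o]_n).

Section Smooth.
Context {R : realType} {n : nat}.
Implicit Types (f : Cn R n -> R[i]) (z v : Cn R n).

Definition rline f z v (t : R) : R[i] := f (z + t%:C *: v).

Definition rderivable f z v : Prop :=
  derivable (fun t => complex.Re (rline f z v t)) 0 1 /\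
  derivable (fun t => complex.Im (rline f z v t)) 0 1.

(* Derivative along v, for the underlying real structure of C^n. *)
Definition rderive v f z : R[i] :=
  derive1 (fun t => complex.Re (rline f z v t)) 0
  +i* derive1 (fun t => complex.Im (rline f z v t)) 0.

Fixpoint Ck (k : nat) (V : set (Cn R n)) f : Prop :=
  (forall z, V z -> {for z, continuous (f : Cn R n -> R[i]^o)}) /\
  if k is k'.+1 then
    (forall z v, V z -> rderivable f z v) /\ (forall v, Ck k' V (rderive v f))
  else True.

Definition smooth_on (V : set (Cn R n)) f : Prop := forall k, Ck k V f.

End Smooth.

(* For maps of normed modules over R[i], [differentiable] is complex
   differentiability, so the transition maps below are holomorphic. *)
Record complex_manifold (R : realType) (n : nat) := ComplexManifold {
  mfd_space :> topologicalType;
  mfd_hausdorff : hausdorff_space mfd_space;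
  mfd_second_countable : @second_countable mfd_space;
  chart_index : Type;
  chart_dom : chart_index -> set mfd_space;
  chart : chart_index -> mfd_space -> Cn R n;
  chart_inv : chart_index -> Cn R n -> mfd_space;
  chart_dom_open : forall i, open (chart_dom i);
  chart_cover : forall x, exists i, chart_dom i x;
  chart_img_open : forall i, open (chart i @` chart_dom i);
  chartK : forall i x, chart_dom i x -> chart_inv i (chart i x) = x;
  chart_continuous : forall i x, chart_dom i x -> {for x, continuous (chart i)};
  chart_inv_continuous : forall i z,
    (chart i @` chart_dom i) z -> {for z, continuous (chart_inv i)};
  chart_holomorphic : forall i j z,
    (chart i @` (chart_dom i `&` chart_dom j)) z ->
    differentiable (chart j \o chart_inv i) z
}.

Arguments chart_index {R n} _.

Section Forms.
Context {R : realType} {n : nat} (X : complex_manifold R n).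

Definition chart_img (i : chart_index X) : set (Cn R n) :=
  chart i @` chart_dom i.

Definition transition (i j : chart_index X) : Cn R n -> Cn R n :=
  chart j \o chart_inv i.

(* A form of degree m is given by its local expressions: [w i z v] is the value,
   at the point of coordinates z in the chart i, on the tangent vectors
   v 0, ..., v (m - 1).  Vectors are taken in a sequence so that all degrees
   share one type; the later entries of v are ignored by forms of degree m. *)
Definition form_field : Type :=
  chart_index X -> Cn R n -> (nat -> Cn R n) -> R[i].

HB.instance Definition _ := GRing.Lmodule.copy form_field
  (chart_index X -> Cn R n -> (nat -> Cn R n) -> R[i]).

(* dz_{f 0} /\ ... /\ dz_{f (p-1)} /\ dzbar_{g 0} /\ ... /\ dzbar_{g (q-1)} *)
Definition dz_dzbar p q (f : 'I_p -> 'I_n) (g : 'I_q -> 'I_n)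
    (v : nat -> Cn R n) : R[i] :=
  \det (\matrix_(a < p + q, b < p + q)
    match fintype.split b with
    | inl b1 => v a 0 (f b1) : R[i]
    | inr b2 => (v a 0 (g b2) : R[i])^*
    end).

(* Omega^{p,q}_X.  Local expressions are 0 off the chart image, so that equal
   forms are equal as functions. *)
Definition is_form (p q : nat) (w : form_field) : Prop :=
  [/\ forall i, exists c : {ffun 'I_p -> 'I_n} -> {ffun 'I_q -> 'I_n} ->
                           Cn R n -> R[i],
        (forall f g, smooth_on (chart_img i) (c f g)) /\
        (forall z v, chart_img i z ->
           w i z v = \sum_f \sum_g c f g z * dz_dzbar f g v),
      forall i z v, ~ chart_img i z -> w i z v = 0 &
      forall i j z v, (chart i @` (chart_dom i `&` chart_dom j)) z ->
        w i z v = w j (transition i j z) (fun a => 'd (transition i j) z (v a))].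

Definition conj_form (w : form_field) : form_field := fun i z v => (w i z v)^*.

Definition seq2 (u v : Cn R n) : nat -> Cn R n := nth 0 [:: u; v].

(* d w = 0 for w of degree 2, evaluated on constant vector fields. *)
Definition closed2 (w : form_field) : Prop :=
  forall i z u v t, chart_img i z ->
    rderive u (fun y => w i y (seq2 v t)) z
    + rderive v (fun y => w i y (seq2 t u)) z
    + rderive t (fun y => w i y (seq2 u v)) z = 0.

Definition positive11 (w : form_field) : Prop :=
  forall i z v, chart_img i z -> v != 0 -> 0 < w i z (seq2 v ('i *: v)).

Definition kahler_form (w : form_field) : Prop :=
  [/\ is_form 1 1 w, conj_form w = w, closed2 w & positive11 w].

Definition is_kahler : Prop := exists w, kahler_form w.

End Forms.

(* Exponential and inverse of operators on a complex vector space.  The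
   exponential series is summed weakly: y = exp(A) x when, for every linear
   functional f, the series of the f (A^j x) / j! converges to f y.  Linear
   functionals separate points, so y is unique; and no topology on V is needed. *)
Section Operators.
Context {R : realType} (V : lmodType R[i]).

Definition is_exp_at (A : V -> V) (x y : V) : Prop :=
  forall f : {scalar V},
    (fun m => (\sum_(j < m) (j`!%:R)^-1 * f (iter j A x)) : R[i]^o) @ \oo
      --> (f y : R[i]^o).

Definition expop (A : V -> V) (x : V) : V := xget 0 [set y | is_exp_at A x y].

Definition invop (A : V -> V) (x : V) : V := xget 0 [set y | A y = x].

Definition automorphism (A : V -> V) : Prop := linear A /\ bijective A.

(* Entire families of operators, again in the weak sense. *)
Definition holomorphic_op (F : R[i] -> V -> V) : Prop :=
  forall (x : V) (f : {scalar V}) (z : R[i]),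
    derivable ((fun y => f (F y x)) : R[i]^o -> R[i]^o) z 1.

End Operators.

Section Powers.
Context {R : realType}.

Definition cexp (z : R[i]) : R[i] :=
  (expR (complex.Re z))%:C * (cos (complex.Im z) +i* sin (complex.Im z)).

Definition log_choice (Log : R[i] -> R[i]) : Prop :=
  (forall mu, mu != 0 -> cexp (Log mu) = mu) /\
  (forall (lam : R) mu, 0 < lam -> mu != 0 ->
     Log (lam%:C * mu) = (ln lam)%:C + Log mu).

Definition cpow (Log : R[i] -> R[i]) (mu z : R[i]) : R[i] := cexp (z * Log mu).

End Powers.

Section Tspaces.
Context {R : realType} {n : nat} (X : complex_manifold R n).

Definition Lambda (p q : nat) (r k : int) : bool :=
  Num.max 0 (Num.max (2 * r + (p + q)%:Z)%:Q
                     ((`|p%:Z - q%:Z| + 2 * r + (p + q)%:Z)%:Q / 2)) <= k%:Q.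

(* The ambient space: [w p q r k] is the component in Omega^{p,q} (x) U^r hbar^k *)
Definition graded : Type := nat -> nat -> int -> int -> form_field X.

HB.instance Definition _ := GRing.Lmodule.copy graded
  (nat -> nat -> int -> int -> form_field X).

(* alpha (x) U^r (x) hbar^k with alpha = xi + conj xi, xi of type (p,q) *)
Definition monomial p q (xi : form_field X) (r k : int) : graded :=
  fun p' q' r' k' =>
    if (r' == r) && (k' == k) then
      (if (p' == p) && (q' == q) then xi else 0)
      + (if (p' == q) && (q' == p) then conj_form xi else 0)
    else 0.

Definition T_generator (w : graded) : Prop :=
  exists p q xi r k,
    [/\ is_form p q xi, Lambda p q r k & w = monomial p q xi r k].

Definition Tspace : set graded :=
  [set w | exists m (a : 'I_m -> R) (s : 'I_m -> graded),
     (forall j, T_generator (s j)) /\ w = \sum_j (a j)%:C *: s j].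

(* Elements of Tspace are fixed by an antilinear involution of the ambient
   space, so its complexification is T + i T; see [Tspace_direct]. *)
Definition TC_set : set graded :=
  [set w | exists x y, [/\ Tspace x, Tspace y & w = x + 'i *: y]].

Definition N_graded (w : graded) : graded := fun p q r k =>
  if Lambda p q r k then w p q (r - 1) (k - 1) else 0.

Definition Phi_graded (w : graded) : graded := fun p q r k =>
  (- r)%:~R *: w p q r k.

Lemma LambdaC (p q : nat) (r k : int) : Lambda p q r k = Lambda q p r k.
Proof. by rewrite /Lambda addnC distrC. Qed.

Lemma N_monomial (p q : nat) xi (r k : int) :
  N_graded (monomial p q xi r k) =
  if Lambda p q (r + 1) (k + 1) then monomial p q xi (r + 1) (k + 1) else 0.
Proof.
apply/funext => p'; apply/funext => q'; apply/funext => r'; apply/funext => k'.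
have -> : (if Lambda p q (r + 1) (k + 1) then monomial p q xi (r + 1) (k + 1)
           else 0) p' q' r' k'
  = if Lambda p q (r + 1) (k + 1) then monomial p q xi (r + 1) (k + 1) p' q' r' k'
    else 0 by case: ifP.
rewrite /N_graded /monomial !subr_eq.
case: eqVneq => [->|_] /=; last by rewrite !if_same.
case: eqVneq => [->|_] /=; last by rewrite !if_same.
case: (boolP ((p' == p) && (q' == q))) => [/andP[/eqP-> /eqP->]|_] //.
case: (boolP ((p' == q) && (q' == p))) => [/andP[/eqP-> /eqP->]|_].
  by rewrite LambdaC.
by rewrite addr0 !if_same.
Qed.

Lemma Phi_monomial (p q : nat) xi (r k : int) :
  Phi_graded (monomial p q xi r k) = (- r)%:~R *: monomial p q xi r k.
Proof.
apply/funext => p'; apply/funext => q'; apply/funext => r'; apply/funext => k'.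
transitivity ((- r)%:~R *: monomial p q xi r k p' q' r' k'); last by [].
rewrite /Phi_graded /monomial; case: eqVneq => [->|_] //=.
by rewrite !scaler0.
Qed.

End Tspaces.

Section Complexification.
Context {R : realType} {n : nat} (X : complex_manifold R n).
Local Notation graded := (graded X).

Lemma complex_comb (V : lmodType R[i]) (a b : R) (x y x' y' : V) :
  (a +i* b) *: (x + 'i *: y) + (x' + 'i *: y') =
  (a%:C *: x + (- b)%:C *: y + x') + 'i *: (b%:C *: x + a%:C *: y + y').
Proof.
have -> : a +i* b = a%:C + 'i * b%:C.
  by apply/eqP;
     rewrite eq_complex /= !(mul0r, mul1r, mulr0, subr0, addr0, add0r) !eqxx.
have ii : 'i * 'i = -1 :> R[i].
  by apply/eqP;
     rewrite eq_complex /= !(mul0r, mul1r, mulr0, sub0r, addr0, oppr0) !eqxx.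
rewrite !scalerDr !scalerDl !scalerA rmorphN /= scaleNr.
rewrite (mulrAC 'i) ii mulN1r scaleNr (mulrC a%:C) !addrA.
by rewrite [LHS](ACl (1*4*5*2*3*6)%AC).
Qed.

Lemma Tspace0 : Tspace (0 : graded).
Proof.
exists 0%N, (fun=> 0), (fun=> 0); split; last by rewrite big_ord0.
by case.
Qed.

Lemma TspaceZ (a : R) (w : graded) : Tspace w -> Tspace (a%:C *: w).
Proof.
move=> [m [b [s [gs ->]]]]; exists m, (fun j => a * b j), s; split=> //.
by rewrite scaler_sumr; apply: eq_bigr => j _; rewrite scalerA -rmorphM.
Qed.

Lemma TspaceD (w w' : graded) : Tspace w -> Tspace w' -> Tspace (w + w').
Proof.
move=> [m [a [s [gs ->]]]] [m' [a' [s' [gs' ->]]]].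
exists (m + m')%N,
  (fun j => match fintype.split j with inl j1 => a j1 | inr j2 => a' j2 end),
  (fun j => match fintype.split j with inl j1 => s j1 | inr j2 => s' j2 end).
split=> [j|]; first by case: fintype.split.
by rewrite big_split_ord /=; congr (_ + _); apply: eq_bigr => j _;
   rewrite ?(unsplitK (inl j)) ?(unsplitK (inr j)).
Qed.

Definition TC_pred : {pred graded} := fun w => `[< TC_set w >].

Lemma TC_submod_closed : submod_closed TC_pred.
Proof.
split=> [|[a b] u v].
  apply/asboolP; exists 0, 0; split; rewrite ?scaler0 ?addr0//; exact: Tspace0.
move=> /asboolP[x [y [Tx Ty ->]]] /asboolP[x' [y' [Tx' Ty' ->]]]; apply/asboolP.
exists (a%:C *: x + (- b)%:C *: y + x'), (b%:C *: x + a%:C *: y + y').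
split; try by do ![apply: TspaceD | apply: TspaceZ].
exact: complex_comb.
Qed.

Lemma N_graded_linear : linear (@N_graded R n X).
Proof.
move=> a u v.
apply/funext => p; apply/funext => q; apply/funext => r; apply/funext => k.
transitivity (a *: N_graded u p q r k + N_graded v p q r k); last by [].
rewrite /N_graded; case: ifP => _; first by [].
by rewrite scaler0 addr0.
Qed.

Lemma Phi_graded_linear : linear (@Phi_graded R n X).
Proof.
move=> a u v.
apply/funext => p; apply/funext => q; apply/funext => r; apply/funext => k.
transitivity (a *: Phi_graded u p q r k + Phi_graded v p q r k); last by [].
transitivity ((- r)%:~R *: (a *: u p q r k + v p q r k)); first by [].
by rewrite /Phi_graded scalerDr !scalerA mulrC.
Qed.

Lemma TC_stable (A : graded -> graded) : linear A ->
  (forall w, T_generator w ->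
     exists b : R, exists2 w', T_generator w' & A w = b%:C *: w') ->
  forall w, TC_set w -> TC_set (A w).
Proof.
move=> linA gA.
pose AL := GRing.isLinear.Build _ _ _ _ A linA.
pose A' : {linear graded -> graded} := HB.pack A AL.
have TA w : Tspace w -> Tspace (A w).
  move=> [m [a [s [gs ->]]]].
  have /choice[b /choice[s' hs']] : forall j, exists b : R, exists w',
      T_generator w' /\ A (s j) = b%:C *: w'.
    by move=> j; have [b [w' gw' Aw']] := gA _ (gs j); exists b, w'.
  exists m, (fun j => a j * b j), s'; split=> [j|]; first by case: (hs' j).
  rewrite -[LHS]/(A' _) linear_sum; apply: eq_bigr => j _.
  by rewrite linearZ /= (hs' j).2 scalerA -rmorphM.
move=> w [x [y [Tx Ty ->]]]; exists (A x), (A y); split; try exact: TA.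
by rewrite -[LHS]/(A' _) linearD linearZ.
Qed.

Lemma N_stable w : TC_set w -> TC_set (N_graded w : graded).
Proof.
apply: TC_stable; first exact: N_graded_linear.
move=> _ [p [q [xi [r [k [hxi hL ->]]]]]]; rewrite N_monomial.
case: ifP => hL'.
  exists 1, (monomial p q xi (r + 1) (k + 1)); last by rewrite scale1r.
  by exists p, q, xi, (r + 1), (k + 1).
by exists 0, (monomial p q xi r k); [exists p, q, xi, r, k|rewrite scale0r].
Qed.

Lemma Phi_stable w : TC_set w -> TC_set (Phi_graded w : graded).
Proof.
apply: TC_stable; first exact: Phi_graded_linear.
move=> _ [p [q [xi [r [k [hxi hL ->]]]]]]; rewrite Phi_monomial.
exists (- r)%:~R, (monomial p q xi r k); first by exists p, q, xi, r, k.
by rewrite rmorph_int.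
Qed.

Lemma Tspace_direct (x y x' y' : graded) :
  Tspace x -> Tspace y -> Tspace x' -> Tspace y' ->
  x + 'i *: y = x' + 'i *: y' -> x = x' /\ y = y'.
Proof.
have realT (w : graded) : Tspace w ->
    forall p q r k, w p q r k = conj_form (w q p r k).
  move=> [m [a [s [gs ->]]]] p q r k.
  have sumE p1 q1 i z v : (\sum_(j < m) (a j)%:C *: s j : graded) p1 q1 r k i z v
      = \sum_(j < m) (a j)%:C * s j p1 q1 r k i z v.
    by elim/big_ind2: _ => // u1 u2 u3 u4 <- <-.
  apply/funext => i; apply/funext => z; apply/funext => v.
  rewrite sumE /conj_form sumE rmorph_sum; apply: eq_bigr => j _.
  rewrite rmorphM /= oppr0; congr (_ * _).
  have [p0 [q0 [xi [r0 [k0 [_ _ ->]]]]]] := gs j.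
  rewrite /monomial; case: ifP => _; last by rewrite /= oppr0.
  rewrite (andbC (q == p0)) (andbC (q == q0)).
  have E (u1 u2 : form_field X) : (u1 + u2) i z v = u1 i z v + u2 i z v by [].
  rewrite !E rmorphD addrC /=; congr (_ + _); case: ifP => _;
    by rewrite /conj_form /= ?oppr0 ?conjcK.
move=> Tx Ty Tx' Ty' e.
have e1 p q r k i z v : x p q r k i z v + 'i * y p q r k i z v =
    x' p q r k i z v + 'i * y' p q r k i z v.
  by have := congr1 (fun w : graded => w p q r k i z v) e.
have e2 p q r k i z v : x p q r k i z v - 'i * y p q r k i z v =
    x' p q r k i z v - 'i * y' p q r k i z v.
  have := congr1 (fun c => c^*) (e1 q p r k i z v).
  rewrite !rmorphD !rmorphM /=.
  rewrite (realT _ Tx) (realT _ Ty) (realT _ Tx') (realT _ Ty') /conj_form.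
  have -> : (0 -i* 1) = - 'i :> R[i] by apply/eqP; rewrite eq_complex /= oppr0 !eqxx.
  by rewrite /= !conjcK !mulNr.
split; apply/funext => p; apply/funext => q; apply/funext => r;
  apply/funext => k; apply/funext => i; apply/funext => z; apply/funext => v;
  have := e1 p q r k i z v; have := e2 p q r k i z v;
  set a := x p q r k i z v; set b := y p q r k i z v;
  set a' := x' p q r k i z v; set b' := y' p q r k i z v.
  move=> h2 h1; have : 2 * a = 2 * a'.
    have -> : 2 * a = (a + 'i * b) + (a - 'i * b).
      by rewrite addrACA subrr addr0 mulr_natl mulr2n.
    by rewrite h1 h2 addrACA subrr addr0 mulr_natl mulr2n.
  by move/mulfI; apply; rewrite pnatr_eq0.
move=> h2 h1; have : (2 * 'i) * b = (2 * 'i) * b'.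
  have D c d : 2 * 'i * d = (c + 'i * d) - (c - 'i * d) :> R[i].
    by rewrite opprB addrC addrA subrK -mulrA mulr_natl mulr2n.
  by rewrite (D a) h1 h2 -D.
move/mulfI; apply; rewrite mulf_neq0 ?pnatr_eq0 // eq_complex /=.
by rewrite oner_eq0 andbF.
Qed.

HB.instance Definition _ := GRing.isSubmodClosed.Build R[i] graded TC_pred
  TC_submod_closed.

Definition TC : Type := {w : graded | TC_pred w}.

HB.instance Definition _ := SubType.on TC.
HB.instance Definition _ := [Choice of TC by <:].
HB.instance Definition _ := [SubChoice_isSubLmodule of TC by <:].

Definition Nop (x : TC) : TC :=
  exist _ (N_graded (val x)) (asboolT (N_stable (asboolW (valP x)))).

Definition Phi (x : TC) : TC :=
  exist _ (Phi_graded (val x)) (asboolT (Phi_stable (asboolW (valP x)))).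

Definition theta (t : R[i]) (a : TC -> TC) : TC -> TC :=
  expop (- t *: Phi) \o a \o expop (t *: Phi).

(* (mu^z - 1) / z with mu^z = exp (z log mu), extended by log mu at z = 0 *)
Definition phi_plus_coef (Log : R[i] -> R[i]) (mu z : R[i]) : R[i] :=
  if z == 0 then Log mu else (cpow Log mu z - 1) / z.

Definition phi_plus Log (mu z : R[i]) : TC -> TC :=
  expop (phi_plus_coef Log mu z *: Nop).

(* exp(- N / z), for z != 0 *)
Definition phi_minus (z : R[i]) : TC -> TC := expop (- z^-1 *: Nop).

Definition phi_loop Log (mu z : R[i]) : TC -> TC :=
  invop (phi_minus z) \o phi_plus Log mu z.

End Complexification.

Arguments phi_plus {R n} X Log mu z _.
Arguments phi_minus {R n} X z _.
Arguments phi_loop {R n} X Log mu z _.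

(* Main.v *)
(* N raises the power of hbar by 1 and that of U by 1, and k >= 2r + m on
   Lambda_(p,q), so N is locally nilpotent: exp(c N) is a finite sum on each
   vector, exp(a N) exp(b N) = exp((a + b) N), and the loop is
   phi_mu(eps) = exp(N / eps) exp((mu^eps - 1) / eps N) = exp(mu^eps / eps N).
   N lowers the eigenvalues of Phi by 1, hence theta_s(exp(c N)) = exp(e^s c N);
   with s = t eps this turns mu^eps into (e^t mu)^eps.  Holomorphy of phi^+
   reduces to that of (mu^z - 1) / z, the only issue being z = 0. *)
Require Import Defs.
From HB Require Import structures.
From mathcomp Require Import all_boot all_order all_algebra.
From mathcomp Require Import complex.
From mathcomp Require Import all_classical all_reals all_analysis.
From mathcomp Require Import ring zify.

Set Implicit Arguments.
Unset Strict Implicit.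
Unset Printing Implicit Defensive.

Import Order.TTheory GRing.Theory Num.Theory.
Import numFieldNormedType.Exports.

Local Open Scope classical_set_scope.
Local Open Scope ring_scope.
Local Open Scope complex_scope.

(** * Partial sums of the exponential series over a numeric field *)

Lemma sum_triangle (V : nmodType) (g : nat -> nat -> V) M :
  \sum_(m < M) \sum_(j < m.+1) g j (m - j)%N =
  \sum_(j < M) \sum_(k < M - j) g j k.
Proof.
elim: M => [|M IH]; first by rewrite !big_ord0.
rewrite big_ord_recr /= IH [RHS]big_ord_recr /= subSnn big_ord1.
rewrite [\sum_(j < M.+1) _]big_ord_recr /= subnn addrA -big_split /=; congr (_ + _).
by apply: eq_bigr => j _; rewrite subSn ?big_ord_recr//= ltnW.
Qed.

Section ExponentialSums.
Context {F : numFieldType}.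
Implicit Types a b : F.

Definition expsum a M : F := \sum_(j < M) (j`!%:R)^-1 * a ^+ j.

Lemma exprD_fact a b m :
  (m`!%:R)^-1 * (a + b) ^+ m =
  \sum_(j < m.+1) (j`!%:R)^-1 * a ^+ j * (((m - j)`!%:R)^-1 * b ^+ (m - j)).
Proof.
rewrite addrC exprDn mulr_sumr; apply: eq_bigr => j _.
have jm : (j <= m)%N by rewrite -ltnS.
have f0 k : k`!%:R != 0 :> F by rewrite pnatr_eq0 -lt0n fact_gt0.
rewrite -mulr_natr -(bin_fact jm) !natrM.
have b0 : 'C(m, j)%:R != 0 :> F by rewrite pnatr_eq0 -lt0n bin_gt0.
by field; rewrite !f0 b0.
Qed.

(** By the binomial formula [expsum (a + b) M] collects the terms with [j + k < M] of the [M] by [M]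
    square of products. What remains of the square is the corner [M <= j + k]. *)
Lemma expsumD_defect a b M :
  expsum a M * expsum b M - expsum (a + b) M =
  \sum_(j < M) \sum_(M - j <= k < M)
     (j`!%:R)^-1 * a ^+ j * ((k`!%:R)^-1 * b ^+ k).
Proof.
pose g j k := (j`!%:R)^-1 * a ^+ j * ((k`!%:R)^-1 * b ^+ k).
have -> : expsum (a + b) M = \sum_(j < M) \sum_(k < M - j) g j k.
  by rewrite -sum_triangle; apply: eq_bigr => m _; rewrite exprD_fact.
rewrite mulr_suml -sumrB; apply: eq_bigr => j _.
rewrite mulr_sumr -(big_mkord xpredT (g j)).
rewrite -(big_mkord xpredT (fun k => _ * ((k`!%:R)^-1 * b ^+ k))).
by rewrite (@big_cat_nat _ _ _ (M - j)) ?leq_subr//= addrAC subrr add0r.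
Qed.

(** The corner sum is a polynomial in [a] and [b] with nonnegative coefficients, so the triangle
    inequality replaces both by their norms. *)
Lemma norm_expsumD_defect a b M :
  `|expsum a M * expsum b M - expsum (a + b) M| <=
  expsum `|a| M * expsum `|b| M - expsum (`|a| + `|b|) M.
Proof.
rewrite !expsumD_defect (le_trans (ler_norm_sum _ _ _))// ler_sum// => j _.
rewrite (le_trans (ler_norm_sum _ _ _))// ler_sum// => k _.
by rewrite !normrM !normrX !normfV !normr_nat.
Qed.

(** Factor [a ^+ d] out of the terms of degree at least [d] and use [j! <= (d + j)!]. *)
Lemma norm_expsum_tail a d M :
  `|expsum a (d + M) - expsum a d| <= `|a| ^+ d * expsum `|a| M.
Proof.
rewrite /expsum big_split_ord /= addrAC subrr add0r mulr_sumr.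
rewrite (le_trans (ler_norm_sum _ _ _))// ler_sum// => j _.
rewrite normrM normrX normfV normr_nat exprD mulrCA.
rewrite ler_wpM2l ?exprn_ge0// ler_wpM2r ?exprn_ge0//.
rewrite lef_pV2 ?posrE ?ltr0n ?fact_gt0// ler_nat.
by rewrite leq_fact// leq_addl.
Qed.

End ExponentialSums.

(** * The complex exponential as the sum of its power series *)

Section ComplexExp.
Context {R : realType}.
Local Notation C := (R[i]).

Lemma cvg_real_complex (u : nat -> R) (l : R) :
  u @ \oo --> l -> (fun m => (u m)%:C : C^o) @ \oo --> (l%:C : C^o).
Proof.
move=> /cvgrPdist_lt ul; apply/cvgrPdist_lt => e e0.
(* A positive element of [R[i]] has imaginary part 0, so its real part serves as the real
   tolerance. *)
have := e0; rewrite ltcE /= => /andP[/eqP ie re].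
have [N _ hN] := ul _ re; exists N => // m /hN /=.
rewrite -rmorphB normc_def /= expr0n /= addr0 sqrtr_sqr ltcE /= ie eqxx.
by [].
Qed.

Lemma expR_cvg (x : R) : expsum x @ \oo --> expR x.
Proof.
have -> : expsum x = series (exp_coeff x).
  apply/funext => m; rewrite /series /= big_mkord.
  by apply: eq_bigr => j _; rewrite mulrC.
exact: is_cvg_series_exp_coeff.
Qed.

Lemma expsum_le_expR (x : R) M : 0 <= x -> expsum x M <= expR x.
Proof.
move=> x0; have nd : nondecreasing_seq (expsum x).
  apply/nondecreasing_seqP => m; rewrite /expsum big_ord_recr /= lerDl.
  by rewrite mulr_ge0 ?invr_ge0 ?exprn_ge0.
have := nondecreasing_cvgn_le nd (cvgP _ (@expR_cvg x)) M.
by rewrite (cvg_lim (@Rhausdorff R) (@expR_cvg x)).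
Qed.

Lemma expsum_real (x : R) M : expsum (x%:C) M = (expsum x M)%:C.
Proof.
rewrite /expsum rmorph_sum; apply: eq_bigr => j _.
by rewrite rmorphM rmorphXn fmorphV rmorph_nat.
Qed.

(** The exponents [m./2] and [m.-1./2] are those of [cos_coeff] and [sin_coeff], which lets
    [expsum_imag] match the series term by term. *)
Lemma expi m : ('i : C) ^+ m =
  if odd m then 0 +i* (-1) ^+ m.-1./2 else ((-1) ^+ m./2)%:C.
Proof.
have ii k : ('i : C) ^+ k.*2 = ((-1) ^+ k)%:C.
  by rewrite -mul2n exprM sqr_i rmorphXn rmorphN1.
rewrite -{1}(odd_double_half m) exprD ii; case: ifPn => om; last by rewrite mul1r.
have -> : m.-1./2 = m./2 by case: m om => //= m /negbTE om; rewrite uphalf_half om.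
by apply/eqP; rewrite eq_complex /=; apply/andP; split; apply/eqP; ring.
Qed.

Lemma expsum_imag (y : R) m :
  expsum ('i * y%:C) m =
  (series (cos_coeff y) m) +i* (series (sin_coeff y) m).
Proof.
rewrite /series /= !big_mkord; elim: m => [|m IH].
  by rewrite /expsum !big_ord0.
rewrite /expsum big_ord_recr /= -/(expsum _ _) IH !big_ord_recr /=.
rewrite exprMn -rmorphXn expi /=.
have -> : (m`!%:R : C)^-1 = (m`!%:R^-1)%:C by rewrite fmorphV rmorph_nat.
rewrite [LHS]/GRing.add /= [cos_coeff y m]/cos_coeff [sin_coeff y m]/sin_coeff /=.
case: (odd m) => /=; apply/eqP; rewrite eq_complex /=.
  by apply/andP; split; apply/eqP; rewrite /exprz /=; ring.
by apply/andP; split; apply/eqP; rewrite /exprz /=; ring.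
Qed.

Lemma expsum_imag_cvg (y : R) :
  (expsum ('i * y%:C) : nat -> C^o) @ \oo --> (cos y +i* sin y : C^o).
Proof.
have -> : (expsum ('i * y%:C) : nat -> C^o) =
   (fun m => (series (cos_coeff y) m)%:C : C^o) +
   (fun m => (series (sin_coeff y) m)%:C * 'i : C^o).
  by apply/funext => m; rewrite expsum_imag [LHS]complexE /= mulrC.
have -> : (cos y +i* sin y : C^o) = ((cos y)%:C : C^o) + ((sin y)%:C * 'i : C^o).
  by rewrite [LHS]complexE /= mulrC.
apply: (@cvgD C C^o).
  by apply: cvg_real_complex; rewrite unlock; apply: is_cvg_series_cos_coeff.
apply: (@cvgM C _ _ _ _ (cst ('i : C^o))); last exact: cvg_cst.
apply: cvg_real_complex; rewrite unlock; apply: is_cvg_series_sin_coeff.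
Qed.

Lemma cvg0_norm_le (u v : nat -> C^o) :
  (forall m, `|u m| <= v m) -> v @ \oo --> (0 : C^o) -> u @ \oo --> (0 : C^o).
Proof.
move=> uv /cvgrPdist_lt v0; apply/cvgrPdist_lt => e /v0 [N _ hN].
exists N => // m /hN /=; rewrite !sub0r !normrN; apply: le_lt_trans.
(* Since [v m] dominates a norm it is real and nonnegative, hence bounded by its own norm. *)
by rewrite (le_trans (uv m))// real_ler_norm// ger0_real// (le_trans _ (uv m)).
Qed.

Lemma norm_normc (z : C) : `|z| = (Normc.normc z)%:C.
Proof. by []. Qed.

(* The product of the partial sums at a and b differs from the partial sum at
   a + b by at most the same expression at |a| and |b|, which tends to 0 by the
   functional equation of the real exponential. *)
Lemma expsum_cvgD (a b la lb : C^o) :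
  (expsum a : nat -> C^o) @ \oo --> la ->
  (expsum b : nat -> C^o) @ \oo --> lb ->
  (expsum (a + b) : nat -> C^o) @ \oo --> (la * lb : C^o).
Proof.
move=> ca cb.
pose u : nat -> C^o := fun m => expsum a m * expsum b m - expsum (a + b) m.
have u0 : u @ \oo --> (0 : C^o).
  pose v : nat -> C^o := fun m =>
    expsum `|a| m * expsum `|b| m - expsum (`|a| + `|b|) m.
  apply: (@cvg0_norm_le _ v) => [m|]; first exact: norm_expsumD_defect.
  rewrite /v !norm_normc -rmorphD; set x := Normc.normc a; set y := Normc.normc b.
  have -> : 0 = ((expR x * expR y - expR (x + y))%:C : C^o) by rewrite expRD subrr.
  under eq_fun do rewrite !expsum_real -rmorphM -rmorphB.
  by apply: cvg_real_complex; apply: cvgB; [apply: cvgM|]; apply: expR_cvg.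
have -> : (expsum (a + b) : nat -> C^o) = (expsum a : nat -> C^o) * expsum b - u.
  apply/funext => m; rewrite /u /GRing.mul /GRing.add /GRing.opp /=.
  by rewrite opprB addrC subrK.
rewrite -(subr0 (la * lb)).
exact: (@cvgB C C^o _ _ _ _ _ _ _ (@cvgM C _ _ _ _ _ _ _ ca cb) u0).
Qed.

(** Links [cexp], defined through [expR], [cos] and [sin], to the series used in [is_exp_at]: split
    [z] into its real and imaginary parts and multiply the two limits. *)
Lemma cexp_cvg (z : C) : (expsum z : nat -> C^o) @ \oo --> (cexp z : C^o).
Proof.
rewrite {1}(complexE z); apply: expsum_cvgD; last exact: expsum_imag_cvg.
rewrite (funext (expsum_real _)); apply: cvg_real_complex.
exact: expR_cvg.
Qed.

Lemma cexpD (a b : C) : cexp (a + b) = cexp a * cexp b.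
Proof.
have h1 := @cexp_cvg (a + b).
have h2 := expsum_cvgD (@cexp_cvg a) (@cexp_cvg b).
have H := @norm_hausdorff C C^o.
exact: etrans (esym (cvg_lim H h1)) (cvg_lim H h2).
Qed.

Lemma cexp_real (x : R) : cexp x%:C = (expR x)%:C.
Proof. by rewrite /cexp /= cos0 sin0 mulr1. Qed.

Lemma cexp0 : cexp 0 = 1 :> C.
Proof. by rewrite (cexp_real 0) expR0. Qed.

Lemma cexpN (a : C) : cexp (- a) * cexp a = 1.
Proof. by rewrite -cexpD addNr cexp0. Qed.

(** The limit of [norm_expsum_tail]: a Taylor remainder after the terms of degree below [d]. The
    cases [d = 2] and [d = 3] yield the derivatives computed below. *)
Lemma norm_cexp_tail (z : C) d :
  `|cexp z - expsum z d| <= `|z| ^+ d * (expR (Normc.normc z))%:C.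
Proof.
apply/ler_addgt0Pr => e e0.
have /cvgrPdist_lt /(_ _ e0) [N _ hN] := @cexp_cvg z.
have := hN (d + N)%N; rewrite /= leq_addl => /(_ isT) h.
rewrite -(subrK (expsum z (d + N)) (cexp z)) -addrA addrC.
rewrite (le_trans (ler_normD _ _))// lerD ?(ltW h)//.
rewrite (le_trans (norm_expsum_tail _ _ _))// ler_wpM2l ?exprn_ge0//.
by rewrite norm_normc expsum_real lecR expsum_le_expR// -ler0c -norm_normc normr_ge0.
Qed.

End ComplexExp.

(** * Complex differentiability of the coefficient of N in the exponent of phi^+ *)

Section Holomorphy.
Context {R : realType}.
Local Notation C := (R[i]).

Lemma derivable_quadratic (f : C^o -> C^o) (z d K : C) : 0 <= K ->
  (forall h : C, `|h| <= 1 -> `|f (h + z) - f z - h * d| <= `|h| ^+ 2 * K) ->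
  derivable f z 1.
Proof.
move=> K0 fK; apply/cvg_ex; exists (d : C^o); apply/cvgrPdist_lt => e e0.
(* Dividing the tolerance by [K + 1] instead of [K] covers the case [K = 0]. *)
have K1 : 0 < K + 1 by rewrite ltr_wpDl.
near=> h.
have h0 : h != 0 by near: h; exact: nbhs_dnbhs_neq.
have h1 : `|h| <= 1 by near: h; apply: dnbhs0_le.
have he : `|h| < e / (K + 1) by near: h; apply: dnbhs0_lt; rewrite divr_gt0.
rewrite distrC /= [h *: 1]mulr1.
have -> : h^-1 *: (f (h + z) - f z) - d = h^-1 * (f (h + z) - f z - h * d).
  by rewrite [RHS]mulrBr mulKf.
rewrite normrM normfV ltr_pdivrMl ?normr_gt0//.
rewrite (le_lt_trans (fK _ h1))// expr2 -mulrA ltr_pM2l ?normr_gt0//.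
rewrite ltr_pdivlMr// in he; apply: le_lt_trans he.
by rewrite ler_wpM2l// lerDl.
Unshelve. all: by end_near.
Qed.

(** For [h] in the unit disk the exponential factor is bounded independently of [h], as the constant
    in [derivable_quadratic] requires. *)
Lemma norm_cexp_tail_unit (h L : C) d : `|h| <= 1 ->
  `|cexp (h * L) - expsum (h * L) d| <=
  `|h| ^+ d * (`|L| ^+ d * (expR (Normc.normc L))%:C).
Proof.
move=> h1; rewrite (le_trans (norm_cexp_tail _ _))// mulrA -exprMn -normrM.
rewrite ler_wpM2l ?exprn_ge0// lecR ler_expR -lecR.
by have : `|h * L| <= `|L| by rewrite normrM ler_piMl.
Qed.

Lemma derivable_cexpM (L z : C) :
  derivable (fun y : C^o => cexp ((y : C) * L) : C^o) (z : C^o) 1.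
Proof.
pose K := `|cexp (z * L)| * (`|L| ^+ 2 * (expR (Normc.normc L))%:C).
apply: (@derivable_quadratic _ _ (cexp (z * L) * L) K) => [|h h1].
  by rewrite !mulr_ge0 ?exprn_ge0// lecR expR_ge0.
have -> : cexp ((h + z) * L) - cexp (z * L) - h * (cexp (z * L) * L) =
    cexp (z * L) * (cexp (h * L) - expsum (h * L) 2).
  rewrite mulrDl cexpD /expsum !big_ord_recr big_ord0 /= !invr1 expr0 expr1.
  by ring.
by rewrite normrM /K mulrCA ler_wpM2l// norm_cexp_tail_unit.
Qed.

(** The singularity at 0 is removable: the expansion starts with [L + h * (L ^+ 2 / 2)], and the
    cubic remainder of the exponential divided by [h] is a quadratic error. Away from 0 the function
    is locally a quotient of differentiable functions. *)
Lemma derivable_phi_plus_coef Log (mu z : C) :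
  derivable (phi_plus_coef Log mu : C^o -> C^o) z 1.
Proof.
pose L := Log mu; have [->|z0] := eqVneq z 0.
  apply: (@derivable_quadratic _ _ (L ^+ 2 / 2)
    (`|L| ^+ 3 * (expR (Normc.normc L))%:C)) => [|h h1].
    by rewrite mulr_ge0 ?exprn_ge0// lecR expR_ge0.
  rewrite addr0 /phi_plus_coef eqxx; have [->|h0] := eqVneq h 0.
    by rewrite subrr mul0r subrr normr0 expr0n mul0r.
  have -> : (cpow Log mu h - 1) / h - Log mu - h * (L ^+ 2 / 2) =
      (cexp (h * L) - expsum (h * L) 3) / h.
    rewrite /cpow /expsum !big_ord_recr big_ord0 /= -/L.
    rewrite (_ : 2`! = 2)%N// fact0 (_ : 1`! = 1)%N// !invr1.
    by rewrite expr0 expr1 add0r !mul1r; field.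
  rewrite normrM normfV ler_pdivrMr ?normr_gt0// mulrAC -exprSr.
  exact: norm_cexp_tail_unit.
pose E : C^o -> C^o := fun y => cexp ((y : C) * L).
apply: (@near_eq_derivable _ _ _ ((E - cst 1) * (fun y => y^-1))).
- near=> y; rewrite /phi_plus_coef ifN//; near: y.
  exact: (@cvgr_neq0 C C^o _ (nbhs (z : C^o)) _ id z (@cvg_id _ _) z0).
- apply: derivableM.
    exact: (derivableB (@derivable_cexpM L z) (@derivable_cst _ _ _ _ _ _)).
  by apply: (@derivableV C C^o id); last exact: derivable_id.
Unshelve. all: by end_near.
Qed.

End Holomorphy.

(** * Weakly summed exponentials of operators *)

Lemma linear_bundle (K : pzRingType) (U W : lmodType K) (B : U -> W) :
  linear B -> exists L : {linear U -> W}, L =1 B.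
Proof.
move=> linB; pose BL := GRing.isLinear.Build _ _ _ _ B linB.
by pose L : {linear U -> W} := HB.pack B BL; exists L.
Qed.

Section OperatorExponential.
Context {R : realType} (V : lmodType R[i]).
Context (sepV : forall x y : V, (forall f : {scalar V}, f x = f y) -> x = y).
Local Notation C := (R[i]).
Implicit Types (A : {linear V -> V}) (x y : V).

Lemma iter_linearP A k : linear (iter k A).
Proof. by elim: k => [|k IH] a x y //=; rewrite IH linearP. Qed.

Lemma iter_scale A c k x : iter k (c *: (A : V -> V)) x = c ^+ k *: iter k A x.
Proof.
elim: k => [|k /= ->]; first by rewrite scale1r.
by rewrite -[LHS]/(c *: A _) linearZ scalerA -exprS.
Qed.

(** Limits in [R[i]] are unique and functionals separate points by [sepV], so the vector chosen by
    [xget] must be the given one. *)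
Lemma expopE (B : V -> V) x y : is_exp_at B x y -> expop B x = y.
Proof.
move=> xy; apply: sepV => f.
have xe : is_exp_at B x (expop B x) by apply: (@xgetPex _ 0); exists y.
have H := @norm_hausdorff C C^o.
exact: etrans (esym (cvg_lim H (xe f))) (cvg_lim H (xy f)).
Qed.

Lemma is_exp_at_lin A c a x y x' y' :
  is_exp_at (c *: (A : V -> V)) x y -> is_exp_at (c *: (A : V -> V)) x' y' ->
  is_exp_at (c *: (A : V -> V)) (a *: x + x') (a *: y + y').
Proof.
move=> xy xy' f; rewrite linearP.
have -> : (fun m => \sum_(j < m) (j`!%:R)^-1 *
      f (iter j (c *: (A : V -> V)) (a *: x + x')) : C^o) =
    (fun m => a * (\sum_(j < m) (j`!%:R)^-1 * f (iter j (c *: (A : V -> V)) x)) : C^o)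
    + (fun m => \sum_(j < m) (j`!%:R)^-1 * f (iter j (c *: (A : V -> V)) x') : C^o).
  apply/funext => m; rewrite -[RHS]/(_ + _) mulr_sumr -big_split /=.
  apply: eq_bigr => j _; rewrite !iter_scale iter_linearP !linearZ linearP /=.
  by ring.
apply: (@cvgD C C^o); last exact: xy'.
by apply: (@cvgM C _ _ _ (cst (a : C^o))); [exact: cvg_cst|exact: xy].
Qed.

Lemma is_exp_at_eigen (B : V -> V) (l : C) x :
  (forall k, iter k B x = l ^+ k *: x) -> is_exp_at B x (cexp l *: x).
Proof.
move=> Bx f; rewrite linearZ /=.
have -> : (fun m => \sum_(j < m) (j`!%:R)^-1 * f (iter j B x) : C^o) =
    (fun m => expsum l m * f x : C^o).
  apply/funext => m; rewrite mulr_suml; apply: eq_bigr => j _.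
  by rewrite Bx linearZ mulrA.
by apply: (@cvgM C _ _ _ _ (cst (f x : C^o))); [exact: cexp_cvg|exact: cvg_cst].
Qed.

(** Where no weak sum exists [expop] returns the default value 0; the existence hypothesis rules
    this out, and linearity of the partial sums then passes to the limit. *)
Lemma expop_linear A c :
  (forall x, exists y, is_exp_at (c *: (A : V -> V)) x y) ->
  linear (expop (c *: (A : V -> V))).
Proof.
move=> ex a x x'; have [[y xy] [y' xy']] := (ex x, ex x').
rewrite (expopE xy) (expopE xy').
exact: (expopE (@is_exp_at_lin A c a _ _ _ _ xy xy')).
Qed.

(** * The one-parameter group generated by a locally nilpotent operator *)

Section LocallyNilpotent.
Context (N : {linear V -> V}) (nilN : forall x, exists M, iter M N x = 0).
Local Notation expN c := (expop (c *: (N : V -> V))).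

Lemma is_exp_at_nil c M x : iter M N x = 0 ->
  is_exp_at (c *: (N : V -> V)) x
    (\sum_(j < M) ((j`!%:R)^-1 * c ^+ j) *: iter j N x).
Proof.
move=> Mx f; apply: cvg_near_cst; exists M => // m /= Mm.
have Nx0 k : iter (k + M) N x = 0.
  by rewrite iterD Mx; elim: k => //= k ->; rewrite linear0.
rewrite -(subnK Mm) addnC big_split_ord /= [X in _ + X]big1 ?addr0 => [|j _].
  by rewrite linear_sum; apply: eq_bigr => j _; rewrite iter_scale !linearZ /= mulrA.
by rewrite iter_scale addnC Nx0 scaler0 linear0 mulr0.
Qed.

Lemma expN_sum c M x : iter M N x = 0 ->
  expN c x = \sum_(j < M) ((j`!%:R)^-1 * c ^+ j) *: iter j N x.
Proof. by move=> Mx; exact: (expopE (@is_exp_at_nil c M x Mx)). Qed.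

Lemma expN_linear c : linear (expN c).
Proof.
apply: expop_linear => x; have [M Mx] := nilN x.
by eexists; exact: (@is_exp_at_nil c M x Mx).
Qed.

Lemma expN0 x : expN 0 x = x.
Proof.
have [M Mx] := nilN x.
(* [M] may be 0; the bound [M.+1] guarantees that the sum contains the term of index 0. *)
have Mx' : iter M.+1 N x = 0 by rewrite iterS Mx linear0.
rewrite (expN_sum _ Mx') big_ord_recl big1 => [|j _].
  by rewrite addr0 /= expr0 mulr1 invr1 scale1r.
by rewrite expr0n /= mulr0 scale0r.
Qed.

(** With [iter M N x = 0], the double sum over [j, k < M] loses all terms with [j + k >= M]. The
    remaining triangle, regrouped along [j + k = m], gives the powers of [a + b] by the binomial
    formula. *)
Lemma expND a b x : expN a (expN b x) = expN (a + b) x.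
Proof.
have [M Mx] := nilN x.
have Nx0 k : (M <= k)%N -> iter k N x = 0.
  by move=> /subnK <-; rewrite iterD Mx; elim: (_ - _)%N => //= m ->; rewrite linear0.
pose c (d : C) j : C := (j`!%:R)^-1 * d ^+ j.
have iN j : iter j N (expN b x) = \sum_(k < M) c b k *: iter (j + k) N x.
  rewrite (expN_sum _ Mx).
  elim: j => //= j ->; rewrite linear_sum; apply: eq_bigr => k _.
  by rewrite linearZ /=.
have MNx : iter M N (expN b x) = 0.
  by rewrite iN big1 => // k _; rewrite Nx0 ?scaler0// leq_addr.
rewrite (expN_sum _ MNx) (expN_sum (a + b) Mx).
transitivity (\sum_(j < M) \sum_(k < M - j) (c a j * c b k) *: iter (j + k) N x).
  apply: eq_bigr => j _; rewrite iN scaler_sumr.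
  rewrite -(big_mkord xpredT (fun k => (c a j * c b k) *: iter (j + k) N x)).
  rewrite -(big_mkord xpredT (fun k => c a j *: (c b k *: iter (j + k) N x))).
  rewrite (@big_cat_nat _ _ _ (M - j)) ?leq_subr//= [X in _ + X]big_nat_cond.
  rewrite [X in _ + X]big1 ?addr0 => [|k]; last first.
    by rewrite andbT leq_subLR => /andP[Mk _]; rewrite Nx0 ?scaler0.
  by apply: eq_bigr => k _; rewrite scalerA.
rewrite -(sum_triangle (fun j k => (c a j * c b k) *: iter (j + k) N x)).
apply: eq_bigr => m _; rewrite exprD_fact scaler_suml; apply: eq_bigr => j _.
by rewrite subnKC// -ltnS.
Qed.

Lemma expNK c : cancel (expN c) (expN (- c)).
Proof. by move=> x; rewrite expND addNr expN0. Qed.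

Lemma expN_automorphism c : automorphism (expN c).
Proof.
split; first exact: expN_linear.
exists (expN (- c)); first exact: expNK.
by have := expNK (- c); rewrite opprK.
Qed.

(** [invop] selects some preimage; injectivity of [expN c] identifies it with the one given by
    [expN (- c)]. *)
Lemma invop_expN c : invop (expN c) = expN (- c).
Proof.
have cK : cancel (expN (- c)) (expN c) by have := expNK (- c); rewrite opprK.
apply/funext => x; apply: (can_inj (expNK c)); rewrite cK.
by apply: (@xgetPex _ 0 [set y | expN c y = x]); exists (expN (- c) x); exact: cK.
Qed.

(** For fixed [x] the nilpotency bound [M] does not depend on [z], so each functional of the family
    is a polynomial in [c z]. *)
Lemma expN_holomorphic (c : C -> C) :
  (forall z, derivable (c : C^o -> C^o) z 1) ->
  holomorphic_op (fun z => expN (c z)).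
Proof.
move=> dc x f z; have [M Mx] := nilN x.
have -> : (fun w => f (expN (c w) x)) = \sum_(j < M)
    (cst ((j`!%:R)^-1 * f (iter j N x) : C^o) * ((c : C^o -> C^o) ^+ j)).
  apply/funext => w; rewrite (expN_sum _ Mx) linear_sum fct_sumE.
  apply: eq_bigr => j _; rewrite linearZ /= -[RHS]/(_ * _) fctE mulrAC.
  by congr (_ * _); rewrite exprfctE.
apply: (@derivable_sum C C^o C^o) => j; apply: derivableM; first exact: derivable_cst.
by apply: derivableX; apply: dc.
Qed.

(** * Conjugation by the exponential of a grading operator *)

Section Grading.
Context (Phi : {linear V -> V}).
Context (commPhiN : forall x, Phi (N x) = N (Phi x) - N x).
(** Diagonalisability of [Phi], stated as an induction principle: the eigenvectors span [V]. *)
Context (spanPhi : forall P : V -> Prop, P 0 ->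
  (forall a x y, P x -> P y -> P (a *: x + y)) ->
  (forall x l, Phi x = l *: x -> P x) -> forall x, P x).
Local Notation expPhi s := (expop (s *: (Phi : V -> V))).

Lemma is_exp_at_Phi s x l : Phi x = l *: x ->
  is_exp_at (s *: (Phi : V -> V)) x (cexp (s * l) *: x).
Proof.
move=> xl; apply: is_exp_at_eigen => k; rewrite iter_scale exprMn -scalerA.
congr (_ *: _); elim: k => [|k /= ->]; first by rewrite scale1r.
by rewrite linearZ /= xl scalerA -exprSr.
Qed.

(** A weak sum exists on every eigenvector, and existence is preserved by linear combinations, so
    [spanPhi] gives it everywhere. *)
Lemma expPhi_linear s : linear (expPhi s).
Proof.
apply: expop_linear; apply: spanPhi => [|a x x' [y xy] [y' xy']|x l xl].
- exists 0 => f; apply: cvg_near_cst; exists 0%N => // m _.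
  rewrite big1 ?linear0// => j _.
  have -> : iter j (s *: (Phi : V -> V)) 0 = 0.
    by elim: (j : nat) => //= k ->; rewrite -[LHS]/(s *: Phi 0) linear0 scaler0.
  by rewrite linear0 mulr0.
- by exists (a *: y + y'); exact: (@is_exp_at_lin Phi s a _ _ _ _ xy xy').
- by eexists; exact: (@is_exp_at_Phi s x l xl).
Qed.

(* If x has eigenvalue l then N ^ j x has eigenvalue l - j, so conjugation by
   exp (s Phi) multiplies the j-th term of exp (c N) by exp (s j). *)
Lemma expPhi_conj s c x :
  expPhi (- s) (expN c (expPhi s x)) = expN (cexp s * c) x.
Proof.
(* Bundling the four exponentials as linear maps makes both sides visibly linear in [x], so that
   [spanPhi] leaves only eigenvectors to treat. *)
have [P EP] := linear_bundle (expPhi_linear s).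
have [P' EP'] := linear_bundle (expPhi_linear (- s)).
have [E EE] := linear_bundle (expN_linear c).
have [E' EE'] := linear_bundle (expN_linear (cexp s * c)).
rewrite -EP -EE -EP' -EE'.
elim/spanPhi: x => [|a x y IHx IHy|x l xl].
- by rewrite !linear0.
- by rewrite !linearP IHx IHy.
rewrite EP (expopE (@is_exp_at_Phi s x l xl)) !linearZ /=.
have [M Mx] := nilN x; rewrite EE EE' !(expN_sum _ Mx).
rewrite linear_sum scaler_sumr; apply: eq_bigr => j _.
have Nj : Phi (iter j N x) = (l - j%:R) *: iter j N x.
  elim: (j : nat) => [|k IH]; first by rewrite subr0.
  rewrite iterS commPhiN IH linearZ /= -[X in _ - X]scale1r -scalerBl.
  by rewrite -addrA -opprD natr1.
rewrite linearZ /= EP' (expopE (@is_exp_at_Phi (- s) _ _ Nj)) !scalerA.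
congr (_ *: _); rewrite exprMn.
have -> : cexp s ^+ j = cexp (s * j%:R).
  elim: (j : nat) => [|k IH]; first by rewrite mulr0 cexp0.
  by rewrite exprS IH -natr1 mulrDr mulr1 cexpD mulrC.
have -> : cexp (- s * (l - j%:R)) = cexp (- (s * l)) * cexp (s * j%:R).
  by rewrite -cexpD; congr cexp; ring.
by rewrite -[RHS]mul1r -(cexpN (s * l)); ring.
Qed.

End Grading.
End LocallyNilpotent.
End OperatorExponential.

(** * The operators N and Phi on the complexified space *)

Section TCOperators.
Context {R : realType} {n : nat} (X : complex_manifold R n).
Local Notation TC := (TC X).
Local Notation graded := (graded X).

(** The functionals that evaluate one component in a chart, at a point and on given tangent vectors
    already separate elements. *)
Lemma TC_separated (x y : TC) : (forall f : {scalar TC}, f x = f y) -> x = y.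
Proof.
move=> fxy; apply: val_inj; apply/funext => p; apply/funext => q.
apply/funext => r; apply/funext => k; apply/funext => i; apply/funext => z.
apply/funext => v; pose B (w : TC) : R[i]^o := val w p q r k i z v.
have linB : linear B by move=> a u w; rewrite /B linearP.
by have [L LB] := linear_bundle linB; have := fxy L; rewrite !LB.
Qed.

Lemma Nop_linear : linear (@Nop R n X).
Proof.
move=> a u v; apply: val_inj; rewrite [RHS]linearP.
by rewrite -[LHS]/(N_graded (val (a *: u + v))) linearP N_graded_linear.
Qed.

Lemma Phi_linear : linear (@Phi R n X).
Proof.
move=> a u v; apply: val_inj; rewrite [RHS]linearP.
by rewrite -[LHS]/(Phi_graded (val (a *: u + v))) linearP Phi_graded_linear.
Qed.

HB.instance Definition _ :=
  GRing.isLinear.Build R[i] TC TC *:%R (@Nop R n X) Nop_linear.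
HB.instance Definition _ :=
  GRing.isLinear.Build R[i] TC TC *:%R (@Phi R n X) Phi_linear.

(** The component of [Nop x] at [r] comes from [r - 1], and [- r = - (r - 1) - 1]; off [Lambda] both
    sides vanish. *)
Lemma Phi_Nop (x : TC) : Phi (Nop x) = Nop (Phi x) - Nop x.
Proof.
apply: val_inj; rewrite linearB /=; apply/funext => p; apply/funext => q.
apply/funext => r; apply/funext => k.
rewrite -[RHS]/(N_graded (Phi_graded (val x)) p q r k - N_graded (val x) p q r k).
rewrite /Phi_graded /N_graded; case: ifP => _; last by rewrite scaler0 subr0.
rewrite opprB intrB intrN scalerBl scale1r scaleNr.
by rewrite addrAC subrr add0r.
Qed.

(** Every element is [u + 'i *: v] with [u] and [v] real combinations of generators, so statements
    stable under complex combinations reduce to monomials. *)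
Lemma TC_ind (P : TC -> Prop) : P 0 ->
  (forall a x y, P x -> P y -> P (a *: x + y)) ->
  (forall p q xi r k x, is_form p q xi -> Lambda p q r k ->
     val x = monomial p q xi r k -> P x) ->
  forall x, P x.
Proof.
move=> P0 PZD Pgen.
have genTC w : T_generator w -> TC_pred (w : graded).
  move=> gw; apply/asboolP; exists w, 0; rewrite scaler0 addr0.
  split=> //; last exact: Tspace0.
  exists 1%N, (fun=> 1), (fun=> w); split=> //.
  by rewrite big_ord1 scale1r.
have PT w : Tspace w -> exists2 x : TC, val x = w & P x.
  move=> [m [a [s [gs ->]]]].
  elim: m a s gs => [|m IH] a s gs; first by exists 0; rewrite ?big_ord0.
  rewrite big_ord_recl.
  have [y yE Py] := IH (fun j => a (lift ord0 j)) (fun j => s (lift ord0 j))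
    (fun j => gs (lift ord0 j)).
  pose x : TC := exist _ (s ord0) (genTC _ (gs ord0)).
  have Px : P x.
    have [p [q [xi [r [k [hxi hL sE]]]]]] := gs ord0.
    exact: (Pgen p q xi r k).
  by exists ((a ord0)%:C *: x + y); [rewrite linearP /= -yE|exact: PZD].
move=> x; have [u [v [/PT[u' <- Pu] /PT[v' <- Pv] xE]]] := asboolW (valP x).
have -> : x = 'i *: v' + u'.
  by apply: val_inj; rewrite xE linearP addrC.
exact: PZD.
Qed.

Lemma Phi_span (P : TC -> Prop) : P 0 ->
  (forall a x y, P x -> P y -> P (a *: x + y)) ->
  (forall x l, Phi x = l *: x -> P x) -> forall x, P x.
Proof.
move=> P0 PZD Pe; apply: TC_ind => // p q xi r k x _ _ xE.
apply: (Pe _ (- r)%:~R); apply: val_inj.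
by rewrite linearZ /= xE Phi_monomial.
Qed.

(** Each application of N raises the left side by 2 and the right side by 1, which is the source of
    nilpotency. *)
Lemma Lambda_bound p q r k : Lambda p q r k -> 2 * r + (p + q)%:Z <= k.
Proof. by rewrite /Lambda !ge_max => /and3P[_ + _]; rewrite ler_int. Qed.

(** The starting index is not assumed to lie in [Lambda], so membership is asserted only after at
    least one step. *)
Lemma iter_N_monomial p q (xi : form_field X) r k j :
  iter j (@N_graded R n X) (monomial p q xi r k) = 0 \/
  (j == 0%N) || Lambda p q (r + j%:Z) (k + j%:Z) /\
  iter j (@N_graded R n X) (monomial p q xi r k) =
    monomial p q xi (r + j%:Z) (k + j%:Z).
Proof.
elim: j => [|j IH]; first by right; rewrite !addr0.
rewrite iterS; case: IH => [->|[_ ->]].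
  left; apply/funext => p'; apply/funext => q'; apply/funext => r'.
  by apply/funext => k'; rewrite /N_graded if_same.
have jS (a : int) : a + j%:Z + 1 = a + j.+1%:Z by lia.
rewrite N_monomial !jS /=.
by case: ifP => L; [right|left].
Qed.

Lemma Nop_nilpotent (x : TC) : exists M, iter M (@Nop R n X) x = 0.
Proof.
have valN M y : val (iter M (@Nop R n X) y) = iter M (@N_graded R n X) (val y).
  by elim: M => //= M ->.
elim/TC_ind: x => [|a x y [M Mx] [M' My]|p q xi r k x _ _ xE].
- by exists 0%N.
- exists (M + M')%N; rewrite iter_linearP {1}addnC !iterD Mx My.
  have N0 m : iter m (@Nop R n X) 0 = 0 by elim: m => //= m ->; rewrite linear0.
  by rewrite !N0 scaler0 addr0.
(* A nonzero [M]-th iterate would need [2 * (r + M) + (p + q) <= k + M], that is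
   [M <= k - 2 * r - (p + q)]; this [M] exceeds that bound. *)
pose M := (absz (k - 2 * r - (p + q)%:Z)%R).+1; exists M.
apply: val_inj; rewrite valN xE.
case: (iter_N_monomial p q xi r k M) => [->//|[/= /Lambda_bound h _]].
by exfalso; move: h; rewrite /M; lia.
Qed.

End TCOperators.

(** * Automorphisms, holomorphy and the scaling identity of the loop *)

Theorem theorem5p2 (R : realType) (n : nat) (X : complex_manifold R n)
    (X_compact : compact [set: X]) (X_kahler : is_kahler X)
    (Log : R[i] -> R[i]) (Log_choice : log_choice Log)
    (mu : R[i]) (mu_neq0 : mu != 0) :
  [/\ forall z : R[i], automorphism (phi_plus X Log mu z),
      holomorphic_op (phi_plus X Log mu),
      forall z : R[i], z != 0 -> automorphism (phi_minus X z) &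
      forall (lam t rho : R) (eps : R[i]),
        lam = expR t -> 0 < rho -> `|eps| = rho%:C ->
        phi_loop X Log (lam%:C * mu) eps =
        theta (t%:C * eps) (phi_loop X Log mu eps)].
Proof.
have sep := @TC_separated R n X; have nil := @Nop_nilpotent R n X.
split=> [z||z _|lam t rho eps -> rho0 epsE].
- exact: expN_automorphism.
- by apply: expN_holomorphic => // z; exact: derivable_phi_plus_coef.
- exact: expN_automorphism.
have eps0 : eps != 0 by rewrite -normr_gt0 epsE ltcR.
(* Inverting [phi_minus] contributes [1 / eps], which cancels the [- 1 / eps] in the coefficient of
   [phi_plus]. *)
have loopE nu : phi_loop X Log nu eps = expop ((cpow Log nu eps / eps) *: @Nop R n X).
  rewrite /phi_loop /phi_minus /phi_plus (invop_expN sep nil).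
  apply/funext => x /=; rewrite (expND sep nil) /phi_plus_coef (negPf eps0).
  have -> : - - eps^-1 + (cpow Log nu eps - 1) / eps = cpow Log nu eps / eps by field.
  by [].
rewrite !loopE; apply/funext => x; rewrite /theta /=.
rewrite (expPhi_conj sep nil (@Phi_Nop R n X) (@Phi_span R n X)).
(* The compatible choice of logarithms gives [Log (e^t mu) = t + Log mu]. *)
have -> : cpow Log ((expR t)%:C * mu) eps = cexp (t%:C * eps) * cpow Log mu eps.
  rewrite /cpow (Log_choice.2 _ _ (expR_gt0 t) mu_neq0) expRK mulrDr cexpD.
  by rewrite [eps * t%:C]mulrC.
by rewrite mulrA.
Qed.
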